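(* Let $H$ be an $n\times n$ Hadamard matrix that contains a closed quadruple $Q$, and let $G_H$ be its Hadamard graph. Let $H'$ be the matrix obtained from $H$ by switching the closed quadruple $Q$ (on some field). Then there exists a switching partition $\{C_1,\dots,C_t,D\}$ of the vertex set of $G_H$ (i.e. one satisfying the conditions of GM-switching) such that the graph obtained from $G_H$ by GM-switching with respect to this partition is the Hadamard graph $G_{H'}$; that is, switching a closed quadruple on $H$ is equivalent to GM-switching on $G_H$.
   Context: A Hadamard matrix is a square $n\times n$ matrix $H$ with entries in $\{1,-1\}$ such that $HH^T=nI$. Write $h_i$ for the $i$-th row and $h_{ij}$ for its entries, and $h_i\circ h_j=(h_{i1}h_{j1},\dots,h_{in}h_{jn})$ for the entrywise (Hadamard) product; $j_n$ denotes the all-ones row vector of length $n$. A closed quadruple is a set of four rows $i,j,k,l$ with $h_i\circ h_j\circ h_k\circ h_l=\pm j_n$. Its fields are the four classes of columns of $H$, where two columns are in the same class iff their restrictions to the rows $i,j,k,l$ are equal or negatives of each other (when $H$ is brought by row/column permutations and negations into a form whose first three rows are $(1\cdots1,-\cdots-,-\cdots-,1\cdots1)$, $(1\cdots1,-\cdots-,1\cdots1,-\cdots-)$, $(1\cdots1,1\cdots1,-\cdots-,-\cdots-)$ in blocks of $n/4$ columns and whose fourth row is all ones, these are the four column blocks). Switching a closed quadruple means negating all entries of the four rows of $Q$ lying in the columns of one field; the result is again a Hadamard matrix. Hadamard graph: for an $m\times n$ $\{1,-1\}$-matrix $H$, $G_H$ has vertices $v_1,\dots,v_m,v'_1,\dots,v'_m,w_1,\dots,w_n,w'_1,\dots,w'_n$;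 if $h_{ij}=1$ it has edges $v_iw_j$ and $v'_iw'_j$, and if $h_{ij}=-1$ it has edges $v_iw'_j$ and $v'_iw_j$; in addition there is a loop at every vertex $v_i$ and $v'_i$ (a vertex with a loop counts as its own neighbour). GM-switching: a partition $\{C_1,\dots,C_t,D\}$ of the vertex set of a graph is a switching partition if (i) for all $i,j\in\{1,\dots,t\}$, every vertex of $C_i$ has the same number of neighbours in $C_j$, and (ii) every vertex of $D$ has $0$, $\tfrac12|C_i|$ or $|C_i|$ neighbours in $C_i$, for each $i$. GM-switching with respect to it means: for every $i$ and every $v\in D$ having exactly $\tfrac12|C_i|$ neighbours in $C_i$, replace the adjacencies between $v$ and $C_i$ by their complement (make $v$ adjacent exactly to the vertices of $C_i$ it was not adjacent to). The resulting graph is cospectral with the original. *)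

(* Defs.v *)
From HB Require Import structures.
From mathcomp Require Import all_boot all_order all_algebra.

Set Implicit Arguments.
Unset Strict Implicit.
Unset Printing Implicit Defensive.

Import GRing.Theory Num.Theory.
Local Open Scope ring_scope.

Definition is_hadamard n (H : 'M[int]_n) : Prop :=
  (forall i j, (H i j == 1) || (H i j == -1)) /\ H *m H^T = n%:R%:M.

Definition closed_quadruple n (H : 'M[int]_n) (Q : {set 'I_n}) : Prop :=
  #|Q| = 4%N /\
  (\row_j \prod_(i in Q) H i j = const_mx 1 \/
   \row_j \prod_(i in Q) H i j = - const_mx 1 :> 'rV[int]_n).

Definition same_field n (H : 'M[int]_n) (Q : {set 'I_n}) : rel 'I_n :=
  fun j k => [forall i in Q, H i j == H i k] || [forall i in Q, H i j == - H i k].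

Definition fields n (H : 'M[int]_n) (Q : {set 'I_n}) : {set {set 'I_n}} :=
  equivalence_partition (same_field H Q) [set: 'I_n].

Definition switch_quadruple n (H : 'M[int]_n) (Q F : {set 'I_n}) : 'M[int]_n :=
  \matrix_(i, j) (if (i \in Q) && (j \in F) then - H i j else H i j).

(* Vertices of the Hadamard graph of an m x n matrix: [inl (false, i)] is v_i,
   [inl (true, i)] is v'_i, [inr (false, j)] is w_j, [inr (true, j)] is w'_j. *)
Notation hvertex m n := ((bool * 'I_m) + (bool * 'I_n))%type.

(* Graphs are adjacency relations on a finite type; a loop at x is [G x x]. *)
Definition hadamard_graph m n (H : 'M[int]_(m, n)) : rel (hvertex m n) :=
  fun x y => match x, y with
  | inl u, inl v => u == v
  | inl (b, i), inr (c, j) | inr (c, j), inl (b, i) =>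
      H i j == (if b == c then 1 else -1)
  | inr _, inr _ => false
  end.

Section GMSwitching.
Variables (V : finType) (G : rel V).
Implicit Types (C : {set {set V}}) (c D : {set V}) (x y : V).

Definition nbrs_in x c : nat := #|[set y in c | G x y]|.

Definition half_adjacent x c : bool := ((nbrs_in x c).*2 == #|c|)%N.

(* The set of cells C = {C_1, ..., C_t} and the set D together partition V;
   D is not one of the C_i. *)
Definition switching_partition C D : Prop :=
  [/\ partition (D |: C) [set: V],
      D \notin C,
      forall c c', c \in C -> c' \in C ->
        forall x y, x \in c -> y \in c -> nbrs_in x c' = nbrs_in y c'
    & forall x c, x \in D -> c \in C ->
        [|| nbrs_in x c == 0%N, half_adjacent x c | nbrs_in x c == #|c|]].

Definition switched_pair C D x y : bool :=
  (x \in D) && [exists c in C, (y \in c) && half_adjacent x c].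

Definition gm_switch C D : rel V :=
  fun x y => G x y (+) (switched_pair C D x y || switched_pair C D y x).

End GMSwitching.

(* Main.v *)
(** The switching partition has [D] = the vertices v_i, v'_i with i in Q.  The
    cells are the pairs {v_i, v'_i} for i outside Q, the pairs {w_j, w'_j} for j
    in F, and, for every other field, the two sets of signed columns of that
    field agreeing on Q.  A vertex of [D] is adjacent to exactly half of each pair
    {w_j, w'_j} with j in F, and to all or none of any other cell, so GM-switching
    negates exactly the block Q x F.  Regularity between cells reduces to the fact
    that a row outside Q is balanced on every field: the vectors
    (H q j)_(q in Q), for j running over representatives of the four fields, are
    pairwise orthogonal, so orthogonality of row i to the rows in Q separates the
    fields. *)
Require Import Defs.
From mathcomp Require Import all_boot all_order all_algebra.
From mathcomp Require Import ring zify.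

Set Implicit Arguments.
Unset Strict Implicit.
Unset Printing Implicit Defensive.

Import GRing.Theory Num.Theory.
Local Open Scope ring_scope.

(** * Sums of signs and neighbour counts *)

Lemma four_signs_balanced (I : finType) (Q : {set I}) (x : I -> int) :
  #|Q| = 4%N -> (forall q, (x q == 1) || (x q == -1)) ->
  \prod_(q in Q) x q = 1 ->
  \sum_(q in Q) x q = 0 \/ exists b : bool, forall q, q \in Q -> x q = (-1) ^+ b.
Proof.
move=> cardQ x_sign; rewrite -!big_enum /=.
have memQ q : (q \in Q) = (q \in enum Q) by rewrite mem_enum.
have : size (enum Q) = 4%N by rewrite -cardE.
case: (enum Q) memQ => [|q1 [|q2 [|q3 [|q4 []]]]] //= memQ _.
rewrite !big_cons !big_nil.
have all_eq (b : bool) : x q1 = (-1) ^+ b -> x q2 = (-1) ^+ b ->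
    x q3 = (-1) ^+ b -> x q4 = (-1) ^+ b ->
    exists b : bool, forall q, q \in Q -> x q = (-1) ^+ b.
  move=> e1 e2 e3 e4; exists b => q; rewrite memQ !inE.
  by case/or4P => /eqP ->.
(* Of the sixteen sign patterns, product 1 leaves only those with two signs of each kind and the two
   constant ones. *)
case/orP: (x_sign q1) => /eqP e1; case/orP: (x_sign q2) => /eqP e2;
case/orP: (x_sign q3) => /eqP e3; case/orP: (x_sign q4) => /eqP e4;
rewrite e1 e2 e3 e4 => // _; solve [by left | right; exact: (all_eq false)
  | right; exact: (all_eq true)].
Qed.

(** A sign [s] satisfies [2 * (s == 1) = 1 + s]; sum this over [A]. *)
Lemma card_pos_signs_balanced (T : finType) (A : {set T}) (g : T -> int) :
  (forall y, y \in A -> (g y == 1) || (g y == -1)) ->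
  \sum_(y in A) g y = 0 -> (#|[set y in A | g y == 1]|.*2 = #|A|)%N.
Proof.
move=> g_sign sum_g0.
suff: (#|[set y in A | g y == 1]|.*2%:Z = #|A|%:Z) by case.
rewrite -muln2 PoszM -[RHS]addr0 -sum_g0 -sum1dep_card -sum1_card.
rewrite !(big_morph Posz PoszD (erefl _)) -big_split /= mulr_suml.
rewrite big_mkcondr /=; apply: eq_bigr => y /g_sign.
by case/orP => /eqP ->.
Qed.

Lemma nbrs_in_set2 (V : finType) (G : rel V) x u v :
  u != v -> nbrs_in G x [set u; v] = (G x u + G x v)%N.
Proof.
move=> neq_uv; rewrite /nbrs_in -sum1dep_card.
rewrite big_mkcondr /= big_setU1 ?inE //= big_set1.
by case: (G x u); case: (G x v).
Qed.

(** * Labels that define the cells *)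

Section SwitchingPartition.
Variables (n : nat) (H : 'M[int]_n) (Q F : {set 'I_n}).
Hypotheses (hadH : is_hadamard H) (quadQ : closed_quadruple H Q).
Hypothesis (fieldF : F \in fields H Q).

Local Notation vertex := (hvertex n n).
Local Notation G := (hadamard_graph H).

Definition signed_entry (u : bool * 'I_n) (i : 'I_n) : int := (-1) ^+ u.1 * H i u.2.

(** The filler 0 outside [Q] makes equality of these functions mean agreement on [Q]. *)
Definition signed_column_on (u : bool * 'I_n) : {ffun 'I_n -> int} :=
  [ffun i => if i \in Q then signed_entry u i else 0].

Lemma signed_column_onP u v :
  reflect {in Q, signed_entry u =1 signed_entry v}
          (signed_column_on u == signed_column_on v).
Proof.
apply: (iffP eqP) => [/ffunP e q Qq | e]; first by have := e q; rewrite !ffunE Qq.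
by apply/ffunP => q; rewrite !ffunE; case: ifP => // /e.
Qed.

(** The blocks of the partition are the fibres of this map, with [None] reserved for [D]. Dropping
    the bit [b] merges a vertex with its primed twin. *)
Definition cell_label (x : vertex) :
    option ('I_n + ('I_n + {ffun 'I_n -> int})) :=
  match x with
  | inl (_, i) => if i \in Q then None else Some (inl i)
  | inr (b, j) => if j \in F then Some (inr (inl j))
                  else Some (inr (inr (signed_column_on (b, j))))
  end.

Definition cell (x : vertex) : {set vertex} := [set y | cell_label x == cell_label y].

Definition quad_rows : {set vertex} := [set x | cell_label x == None].

Definition cells : {set {set vertex}} := [set cell x | x in ~: quad_rows].

(** * Balance of the rows outside the quadruple *)

Lemma entry_sign i j : (H i j == 1) || (H i j == -1).
Proof. by case: hadH. Qed.

Lemma sqr_entry i j : H i j * H i j = 1.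
Proof. by case/orP: (entry_sign i j) => /eqP ->. Qed.

Lemma rows_orthogonal i q : i != q -> \sum_k H i k * H q k = 0.
Proof.
case: hadH => _ /matrixP /(_ i q); rewrite !mxE => e neq_iq.
rewrite (negPf neq_iq) mulr0n in e; rewrite -[RHS]e.
by apply: eq_bigr => k _; rewrite mxE.
Qed.

Lemma column_products_on_quad j k : \prod_(q in Q) (H q j * H q k) = 1.
Proof.
have [_ e] := quadQ; rewrite big_split /=.
by case: e => /rowP e; have := e j; have := e k; rewrite !mxE => -> ->.
Qed.

(** The entrywise product of the two columns on [Q] consists of four signs with product 1. *)
Lemma columns_on_quad j k :
  \sum_(q in Q) H q j * H q k = 0 \/
  exists b : bool, {in Q, forall q, H q k = (-1) ^+ b * H q j}.
Proof.
have [cardQ _] := quadQ.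
case: (four_signs_balanced cardQ _ (column_products_on_quad j k)).
- move=> q; case/orP: (entry_sign q j) => /eqP ->;
  by case/orP: (entry_sign q k) => /eqP ->.
- by left.
case=> b e; right; exists b => q /e <-.
by rewrite mulrAC sqr_entry mul1r.
Qed.

Lemma quad_nonempty : exists q, q \in Q.
Proof. by apply/card_gt0P; case: quadQ => ->. Qed.

(** On [Q], the inner product of two columns is 0 or ±4, and it is nonzero exactly when one signed
    copy of column [k] agrees with [u]. The condition of agreement thus becomes a linear expression
    in the rows of [Q]. *)
Lemma sum_same_on_quad (u : bool * 'I_n) i k :
  \sum_(c : bool | signed_column_on u == signed_column_on (c, k))
     4%:Z * signed_entry (c, k) i =
  \sum_(q in Q) (H i k * H q k) * signed_entry u q.
Proof.
case: u => b j; have [cardQ _] := quadQ; have [q0 Qq0] := quad_nonempty.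
have -> : \sum_(q in Q) (H i k * H q k) * signed_entry (b, j) q =
    (-1) ^+ b * H i k * \sum_(q in Q) H q j * H q k.
  by rewrite mulr_sumr; apply: eq_bigr => q _; rewrite /signed_entry /=; ring.
case: (columns_on_quad j k) => [sum0 | [b' e]].
  (* No signed copy of column [k] can agree with [u]: the inner product would then be ±4. *)
  rewrite sum0 mulr0 big_pred0 // => c; apply/negP => /signed_column_onP e.
  suff: \sum_(q in Q) H q j * H q k = (-1) ^+ b * (-1) ^+ c * 4%:Z.
    by rewrite sum0; case: (b); case: (c).
  rewrite -cardQ -sum1_card (big_morph Posz PoszD (erefl _)) mulr_sumr.
  apply: eq_bigr => q Qq; have := e q Qq; rewrite /signed_entry /=.
  have := sqr_entry q j; case: (b); case: (c) => /= s1 s2; nia.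
rewrite [in RHS](eq_bigr (fun _ => (-1) ^+ b')) => [|q Qq]; last first.
  by rewrite e // mulrCA sqr_entry mulr1.
rewrite [in RHS]sumr_const cardQ.
(* Exactly one of the two copies agrees, and its sign is determined by any single row [q0] of
   [Q]. *)
rewrite (big_pred1 (b (+) b')) => [|c /=].
  by rewrite /signed_entry /= signr_addb -mulr_natr; ring.
apply/signed_column_onP/eqP => [/(_ q0 Qq0) | ->].
  rewrite /signed_entry /= e //; case/orP: (entry_sign q0 j) => /eqP ->.
    by case: (b); case: (b'); case: c.
  by case: (b); case: (b'); case: c.
move=> q Qq; rewrite /signed_entry /= e // mulrA -signr_addb.
by case: (b); case: (b').
Qed.

(** After multiplication by 4, [sum_same_on_quad] turns the sum into a combination of inner products
    of row [i] with rows of [Q], which all vanish. *)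
Lemma row_balanced (u : bool * 'I_n) i : i \notin Q ->
  \sum_(v | signed_column_on u == signed_column_on v) signed_entry v i = 0.
Proof.
move=> Q'i; apply: (@mulfI _ 4%:Z) => //; rewrite mulr0 mulr_sumr.
transitivity (\sum_k \sum_(c : bool | signed_column_on u == signed_column_on (c, k))
     4%:Z * signed_entry (c, k) i).
  rewrite (exchange_big_dep predT) //= pair_big_dep /=.
  by apply: eq_big => [[c k]|[c k] _].
under eq_bigr do rewrite sum_same_on_quad.
rewrite exchange_big big1 //= => q Qq; rewrite -mulr_suml rows_orthogonal ?mul0r //.
by apply: contraNneq Q'i => ->.
Qed.

(** Fields ignore the sign of a column, so a class of agreeing signed columns cannot lie partly
    inside [F]. *)
Lemma same_signed_column_field u v :
  signed_column_on u = signed_column_on v -> (u.2 \in F) = (v.2 \in F).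
Proof.
move=> /eqP /signed_column_onP e.
case/imsetP: fieldF => j0 _ ->; rewrite !inE /=.
case: u v e => b j [c k] e /=.
have [s ejk] : exists s : bool, {in Q, forall q, H q j = (-1) ^+ s * H q k}.
  exists (b (+) c) => q /e; rewrite /signed_entry /= signr_addb => ekj.
  by rewrite -mulrA -ekj mulrA -signr_addb addbb mul1r.
rewrite /same_field; case: s ejk => /= ejk.
  (* A sign -1 exchanges the two alternatives in [same_field]. *)
  rewrite orbC; congr orb; apply: eq_forallb_in => q Qq; rewrite ejk //;
  by rewrite expr1 mulN1r ?opprK.
by congr orb; apply: eq_forallb_in => q Qq; rewrite ejk // mul1r.
Qed.

(** * Explicit form of the cells *)

Lemma cell_row b k : k \notin Q -> cell (inl (b, k)) = [set inl (false, k); inl (true, k)].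
Proof.
move=> Q'k; apply/setP => -[[c i]|[c j]]; rewrite !inE /= (negPf Q'k); last by case: ifP.
have inlE d : (inl (c, i) == inl (d, k) :> vertex) = (c == d) && (i == k) by [].
rewrite !inlE; case: ifP => [Qi | _].
  by have [eik | _] := eqVneq i k; [rewrite -eik Qi in Q'k | rewrite !andbF].
have -> : (Some (inl k) == Some (inl i) :> option ('I_n + ('I_n + {ffun 'I_n -> int})))
    = (k == i) by [].
by rewrite eq_sym; case: (c); rewrite ?orbF.
Qed.

Lemma cell_field_column b j : j \in F ->
  cell (inr (b, j)) = [set inr (false, j); inr (true, j)].
Proof.
move=> Fj; apply/setP => -[[c i]|[c k]]; rewrite !inE /= Fj; first by case: ifP.
have inrE d : (inr (c, k) == inr (d, j) :> vertex) = (c == d) && (k == j) by [].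
rewrite !inrE; case: ifP => [_ | F'k].
  have -> : (Some (inr (inl j)) == Some (inr (inl k))
      :> option ('I_n + ('I_n + {ffun 'I_n -> int}))) = (j == k) by [].
  by rewrite eq_sym; case: (c); rewrite ?orbF.
by have [ekj | _] := eqVneq k j; [rewrite -ekj F'k in Fj | rewrite !andbF].
Qed.

Lemma cell_other_column u : u.2 \notin F ->
  cell (inr u) = inr @: [set v | signed_column_on u == signed_column_on v].
Proof.
case: u => b j /= F'j; apply/setP => -[[c i]|v]; rewrite !inE /= (negPf F'j).
  transitivity false; first by case: ifP.
  by apply/esym/imsetP => -[].
rewrite mem_imset ?inE; last by move=> ? ? [].
case: v => c k; case: ifP => [Fk | _ //].
apply/esym/negP => /eqP /same_signed_column_field /=.
by rewrite Fk (negPf F'j).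
Qed.

Lemma card_cell_row b k : k \notin Q -> #|cell (inl (b, k))| = 2%N.
Proof. by move/cell_row => ->; rewrite cards2. Qed.

Lemma card_cell_field_column b j : j \in F -> #|cell (inr (b, j))| = 2%N.
Proof. by move/cell_field_column => ->; rewrite cards2. Qed.

(** * Numbers of neighbours in each cell *)

Lemma edgeE b i u : G (inl (b, i)) (inr u) = ((-1) ^+ b * signed_entry u i == 1).
Proof.
case: u => c j; rewrite /signed_entry /=.
by case/orP: (entry_sign i j) => /eqP ->; case: b; case: c.
Qed.

Lemma edgesD b i j : (G (inl (b, i)) (inr (false, j)) + G (inl (b, i)) (inr (true, j)) = 1)%N.
Proof. by case/orP: (entry_sign i j) => /= /eqP ->; case: b. Qed.

Lemma edgesDr b i j : (G (inr (b, j)) (inl (false, i)) + G (inr (b, j)) (inl (true, i)) = 1)%N.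
Proof. by case/orP: (entry_sign i j) => /= /eqP ->; case: b. Qed.

(** Between row vertices the only edges are loops, which give the count [k == i]. *)
Lemma nbrs_cell_row x b k : k \notin Q ->
  nbrs_in G x (cell (inl (b, k))) = if x is inl (_, i) then (k == i)%N else 1%N.
Proof.
move=> Q'k; rewrite cell_row // nbrs_in_set2 //.
case: x => [[c i]|[c j]]; last exact: edgesDr.
rewrite /hadamard_graph !xpair_eqE (eq_sym k).
by case: c; rewrite ?addn0.
Qed.

Lemma nbrs_cell_field_column x b j : j \in F ->
  nbrs_in G x (cell (inr (b, j))) = if x is inl _ then 1%N else 0%N.
Proof.
move=> Fj; rewrite cell_field_column // nbrs_in_set2 //.
by case: x => [[c i]|[c k]] //; exact: edgesD.
Qed.

Lemma nbrs_column_other_column v u : u.2 \notin F ->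
  nbrs_in G (inr v) (cell (inr u)) = 0%N.
Proof.
move=> F'u; apply/eqP; rewrite cards_eq0; apply/eqP/setP => y; rewrite cell_other_column // !inE.
by apply/negP => /andP[/imsetP[w _ ->]]; case: (v); case: (w).
Qed.

(** The signed columns in the cell have the same entry in row [i], so adjacency is constant on the
    cell. *)
Lemma nbrs_quad_row_other_column b i u : i \in Q -> u.2 \notin F ->
  nbrs_in G (inl (b, i)) (cell (inr u)) =
    if G (inl (b, i)) (inr u) then #|cell (inr u)| else 0%N.
Proof.
move=> Qi F'u.
have same_edge y : y \in cell (inr u) -> G (inl (b, i)) y = G (inl (b, i)) (inr u).
  rewrite cell_other_column // => /imsetP[v]; rewrite inE => /signed_column_onP e ->.
  by rewrite !edgeE e.
rewrite /nbrs_in; case: ifP => Gu.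
  by apply: eq_card => y; rewrite in_set andb_idr // => /same_edge ->.
apply/eqP; rewrite cards_eq0; apply/eqP/setP => y; rewrite in_set in_set0.
by apply/negP => /andP[/same_edge ->]; rewrite Gu.
Qed.

Lemma half_adjacent_row_other_column b i u : i \notin Q -> u.2 \notin F ->
  half_adjacent G (inl (b, i)) (cell (inr u)).
Proof.
move=> Q'i F'u; apply/eqP.
pose g (y : vertex) := if y is inr v then (-1) ^+ b * signed_entry v i else 0.
have g_sign y : y \in cell (inr u) -> (g y == 1) || (g y == -1).
  rewrite cell_other_column // => /imsetP[[c k] _ ->] /=; rewrite /signed_entry /=.
  by case/orP: (entry_sign i k) => /eqP ->; case: b @g; case: c.
rewrite -(card_pos_signs_balanced g_sign).
  congr _.*2; apply: eq_card => y; rewrite [LHS]in_set [RHS]in_set; apply: andb_id2l.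
  by rewrite cell_other_column // => /imsetP[v _ ->]; rewrite edgeE.
rewrite cell_other_column // big_imset /=; last by move=> v w _ _ [].
rewrite -mulr_sumr (eq_bigl (fun v => signed_column_on u == signed_column_on v)).
  by rewrite row_balanced ?mulr0.
by move=> v; rewrite inE.
Qed.

(** * The conditions for GM-switching *)

Lemma mem_cell x : x \in cell x.
Proof. by rewrite inE. Qed.

Lemma cells_partition : partition (quad_rows |: cells) [set: vertex].
Proof.
suff -> : quad_rows |: cells = preim_partition cell_label [set: vertex].
  exact: preim_partitionP.
have cellT x : [set y in [set: vertex] | cell_label x == cell_label y] = cell x.
  by apply/setP => y; rewrite !inE.
have quad_rows_cell x : x \in quad_rows -> quad_rows = cell x.
  by rewrite inE => /eqP e; apply/setP => y; rewrite !inE e eq_sym.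
apply/setP => A; rewrite in_setU1; apply/orP/imsetP => [[/eqP -> | /imsetP[x _ ->]] | [x _ ->]].
(* A row of [Q] shows that [quad_rows] is a nonempty fibre. *)
- have [q Qq] := quad_nonempty; exists (inl (false, q)) => //; rewrite cellT.
  by apply: quad_rows_cell; rewrite inE /= Qq.
- by exists x => //; rewrite cellT.
rewrite /= cellT; have [Dx | D'x] := boolP (x \in quad_rows).
  by left; rewrite -(quad_rows_cell x Dx).
by right; apply: imset_f; rewrite inE.
Qed.

Lemma cellsP c : c \in cells ->
  [\/ exists b k, k \notin Q /\ c = cell (inl (b, k)),
      exists b j, j \in F /\ c = cell (inr (b, j))
    | exists u, u.2 \notin F /\ c = cell (inr u)].
Proof.
case/imsetP => -[[b k]|[b j]]; rewrite !inE /= => nD ->.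
  by constructor 1; exists b, k; split=> //; apply: contraNN nD => ->.
have [Fj | F'j] := boolP (j \in F); first by constructor 2; exists b, j.
by constructor 3; exists (b, j).
Qed.

Lemma cells_regular c c' : c \in cells -> c' \in cells ->
  forall x y, x \in c -> y \in c -> nbrs_in G x c' = nbrs_in G y c'.
Proof.
move=> /imsetP[z]; rewrite !inE => Dz -> /cellsP Cc' x y.
rewrite !inE => /eqP ezx /eqP ezy.
have nDx : cell_label x != None by rewrite -ezx.
have {ezx ezy} exy : cell_label x = cell_label y by rewrite -ezx.
case: Cc' => [[b [k [Q'k ->]]] | [b [j [Fj ->]]] | [u [F'u ->]]].
- rewrite !nbrs_cell_row //; move: x y nDx exy => [[a i]|[a j]] [[d l]|[d m]] //=;
  by do 2?case: ifP => // _; move=> _ [->].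
- rewrite !nbrs_cell_field_column //.
  by move: x y nDx exy => [[a i]|[a k]] [[d l]|[d m]] //=; do 2?case: ifP.
move: x y nDx exy => [[a i]|v] [[d l]|w]; rewrite ?nbrs_column_other_column //=.
(* Neither row is in [Q], so each is adjacent to exactly half of the cell. *)
- case: ifPn => // Q'i; case: ifPn => // Q'l _ _; apply: double_inj.
  by do 2!rewrite (eqP (half_adjacent_row_other_column _ _ _)) //.
- by case: w => ? ?; do 2?case: ifP.
by case: v => ? ?; do 2?case: ifP.
Qed.

Lemma hadamard_switching_partition : switching_partition G cells quad_rows.
Proof.
split; first exact: cells_partition.
- apply/imsetP => -[x]; rewrite !inE => nDx /setP /(_ x).
  by rewrite mem_cell inE (negPf nDx).
- exact: cells_regular.
move=> x c; rewrite inE; case: x => [[a i]|[a j]] /=; last by case: ifP.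
case: ifP => // Qi _ /cellsP [[b [k [Q'k ->]]] | [b [j [Fj ->]]] | [u [F'u ->]]].
- rewrite nbrs_cell_row //; have [eki|//] := eqVneq k i.
  by rewrite -eki (negPf Q'k) in Qi.
- by rewrite /half_adjacent nbrs_cell_field_column // card_cell_field_column.
rewrite nbrs_quad_row_other_column //; case: ifP => _ //.
by rewrite eqxx !orbT.
Qed.

(** * Effect of the switching on the graph *)

Lemma switched_pair_cell x y :
  switched_pair G cells quad_rows x y =
  [&& x \in quad_rows, y \notin quad_rows & half_adjacent G x (cell y)].
Proof.
congr andb; apply/existsP/andP => [[c /andP[/imsetP[z Dz ->] /andP[zy half_z]]] | [nDy half_y]].
  rewrite inE in zy; have -> : cell y = cell z by apply/setP => w; rewrite !inE (eqP zy).
  by split=> //; move: Dz; rewrite !inE (eqP zy).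
by exists (cell y); rewrite mem_cell half_y imset_f // inE.
Qed.

Lemma switched_pairE x y :
  switched_pair G cells quad_rows x y =
  match x, y with
  | inl (_, i), inr (_, j) => (i \in Q) && (j \in F)
  | _, _ => false
  end.
Proof.
rewrite switched_pair_cell !inE; case: x => [[a i]|[a j]] /=; last by case: ifP.
case: ifP => [Qi | _]; last by case: y => [[]|[]].
case: y => [[b k]|[b j]] /=.
  case: ifPn => // Q'k; rewrite /half_adjacent nbrs_cell_row // card_cell_row //.
  by have [eki|] := eqVneq k i; [rewrite -eki (negPf Q'k) in Qi | ].
have [Fj | F'j] := boolP (j \in F).
  by rewrite /half_adjacent nbrs_cell_field_column // card_cell_field_column.
(* Since the cell is nonempty, neither none nor all of it counts as half. *)
have : (0 < #|cell (inr (b, j))|)%N by apply/card_gt0P; exists (inr (b, j)); exact: mem_cell.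
rewrite /half_adjacent nbrs_quad_row_other_column //=.
by case: ifP => _; case: #|_| => // m _; apply/negbTE/eqP; lia.
Qed.

Lemma gm_switch_hadamard_graph :
  gm_switch G cells quad_rows =2 hadamard_graph (switch_quadruple H Q F).
Proof.
move=> x y; rewrite /gm_switch !switched_pairE.
(* For an entry ±1, complementing the adjacency amounts to negating the entry. *)
have flip (s t : bool) i j :
    (H i j == (if s then 1 else -1)) (+) t =
    ((if t then - H i j else H i j) == (if s then 1 else -1)).
  by case/orP: (entry_sign i j) => /eqP ->; case: s; case: t.
case: x y => [[a i]|[a j]] [[b k]|[b l]] //=.
- by rewrite addbF.
- by rewrite orbF mxE flip.
by rewrite mxE flip.
Qed.

End SwitchingPartition.

Theorem theorem3p1 (n : nat) (H : 'M[int]_n) (Q F : {set 'I_n})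
    (hadH : is_hadamard H) (quadQ : closed_quadruple H Q)
    (fieldF : F \in fields H Q) :
  exists (C : {set {set hvertex n n}}) (D : {set hvertex n n}),
    switching_partition (hadamard_graph H) C D /\
    gm_switch (hadamard_graph H) C D
      =2 hadamard_graph (switch_quadruple H Q F).
Proof.
exists (cells H Q F), (quad_rows H Q F).
by split; [exact: hadamard_switching_partition | exact: gm_switch_hadamard_graph].
Qed.
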